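(* Let $G$ be a locally finite weakly connected digraph and $r \in V(G)$. Let $F \subseteq E(G)$ be an edge set containing, for every bipartition $(X,Y)$ of $V(G)$ with $r \in X$ and only finitely many edges of $G$ between $X$ and $Y$ (in either direction), an edge directed from $X$ to $Y$. Then the following statements are equivalent. (i) $F$ is a spanning pseudo-arborescence rooted in $r$. (ii) For every vertex $v \neq r$ of $G$ there is a unique edge in $F$ whose head is $v$, and no edge in $F$ has $r$ as its head. (iii) For every weak component $T$ of $G[F]$ the following holds: if $r \in V(T)$, then $T$ is an arborescence rooted in $r$; otherwise, the underlying multigraph of $T$ is a tree, $T$ contains a backwards directed ray, and all other edges of $T$ are directed away from that ray.
   Context: Digraphs may be infinite and may have parallel edges but no loops. A digraph is weakly connected if its underlying undirected multigraph is connected, and locally finite if every vertex has finite in- and out-degree. The two classes of a bipartition are non-empty. An edge is directed from $X$ to $Y$ if its tail is in $X$ and its head is in $Y$. $d^-(v)$ and $d^+(v)$ denote in-degree and out-degree. A spanning pseudo-arborescence rooted in $r\in V(G)$ is an inclusion-wise minimal edge set $F \subseteq E(G)$ among those edge sets that contain, for every bipartition $(X,Y)$ of $V(G)$ with $r \in X$ and only finitely many edges of $G$ between $X$ and $Y$ (in either direction), an edge directed from $X$ to $Y$. $G[F]$ is the subgraph of $G$ with edge set $F$ whose vertices are the endvertices of edges in $F$. A weak component of a digraph is a maximal weakly connected subgraph. An arborescence rooted in a vertex $r$ is a digraph $A$ with $r\in V(A)$ whose underlying multigraph is a tree and such that $d^-(r)=0$ and $d^-(v)=1$ for every $v \in V(A)\setminus\{r\}$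 (degrees in $A$). A backwards directed ray is a weakly connected digraph $R$ with a unique vertex $v$ satisfying $d^-(v)=1$ and $d^+(v)=0$, while $d^-(w)=d^+(w)=1$ for every other vertex $w$ of $R$; that is, a one-way infinite path with all edges directed towards its first vertex. In a digraph $T$ whose underlying multigraph is a tree and which contains a backwards directed ray $R$, an edge $e$ not in $R$ is directed away from $R$ if the tail of $e$ lies in the same weak component of $T-e$ as $R$. *)

(* Defs.v *)
From mathcomp Require Import all_boot.
From mathcomp Require Import boolp classical_sets functions cardinality.

Set Implicit Arguments.
Unset Strict Implicit.
Unset Printing Implicit Defensive.

Local Open Scope classical_set_scope.
Local Open Scope card_scope.

Record digraph := Digraph {
  vertex : Type;
  edge : Type;
  etail : edge -> vertex;
  ehead : edge -> vertex;
  no_loop : forall e, etail e <> ehead e }.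

(* All digraphs occurring below (components, trees, rays) are subgraphs of one
   ambient digraph; the ambient digraph itself is [full G]. *)
Record subgraph (G : digraph) := Subgraph {
  vset : set (vertex G);
  eset : set (edge G);
  vset_etail : forall e, eset e -> vset (etail e);
  vset_ehead : forall e, eset e -> vset (ehead e) }.

Definition full (G : digraph) : subgraph G :=
  @Subgraph G setT setT (fun _ _ => I) (fun _ _ => I).

Definition subgraph_of (G : digraph) (H D : subgraph G) : Prop :=
  vset H `<=` vset D /\ eset H `<=` eset D.

Definition edge_subgraph (G : digraph) (F : set (edge G)) : subgraph G :=
  @Subgraph G
    [set v | exists2 e, F e & etail e = v \/ ehead e = v] F
    (fun e Fe => ex_intro2 _ _ e Fe (or_introl erefl))
    (fun e Fe => ex_intro2 _ _ e Fe (or_intror erefl)).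

Definition delete_edge (G : digraph) (D : subgraph G) (e : edge G) :
    subgraph G :=
  @Subgraph G (vset D) (eset D `\ e)
    (fun _ H => vset_etail (proj1 H)) (fun _ H => vset_ehead (proj1 H)).

Section Degrees.
Variables (G : digraph) (D : subgraph G) (v : vertex G).

Definition in_edges : set (edge G) := [set e | eset D e /\ ehead e = v].
Definition out_edges : set (edge G) := [set e | eset D e /\ etail e = v].

Definition indegree_is (n : nat) : Prop := in_edges #= `I_n.
Definition outdegree_is (n : nat) : Prop := out_edges #= `I_n.

End Degrees.

Definition locally_finite (G : digraph) : Prop :=
  forall v, finite_set (in_edges (full G) v) /\
            finite_set (out_edges (full G) v).

Section Underlying_multigraph.
Variables (G : digraph) (D : subgraph G).

Definition joins (e : edge G) (u v : vertex G) : Prop :=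
  (etail e = u /\ ehead e = v) \/ (etail e = v /\ ehead e = u).

(* The undirected walk x 0, f 0, x 1, ..., f (n - 1), x n of length n; the
   values of x beyond n and of f from n on are irrelevant. *)
Definition walk (n : nat) (x : nat -> vertex G) (f : nat -> edge G) : Prop :=
  vset D (x 0) /\
  forall i, i < n -> eset D (f i) /\ joins (f i) (x i) (x i.+1).

Definition cycle_in (n : nat) (x : nat -> vertex G) (f : nat -> edge G) :
    Prop :=
  [/\ 0 < n, walk n x f, x n = x 0,
      forall i j, i < n -> j < n -> x i = x j -> i = j
    & forall i j, i < n -> j < n -> f i = f j -> i = j].

(* Connected graphs are non-empty; in particular weak components are. *)
Definition weakly_connected : Prop :=
  vset D !=set0 /\
  forall u v, vset D u -> vset D v ->
    exists n x f, [/\ walk n x f, x 0 = u & x n = v].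

Definition underlying_tree : Prop :=
  weakly_connected /\ ~ exists n x f, cycle_in n x f.

End Underlying_multigraph.

Definition weak_component (G : digraph) (D T : subgraph G) : Prop :=
  [/\ subgraph_of T D, weakly_connected T
    & forall T', subgraph_of T' D -> weakly_connected T' ->
        subgraph_of T T' -> subgraph_of T' T].

Definition arborescence (G : digraph) (A : subgraph G) (r : vertex G) : Prop :=
  [/\ vset A r, underlying_tree A, indegree_is A r 0
    & forall v, vset A v -> v <> r -> indegree_is A v 1].

Definition backwards_ray (G : digraph) (R : subgraph G) : Prop :=
  weakly_connected R /\
  exists v,
    unique (fun u => [/\ vset R u, indegree_is R u 1 & outdegree_is R u 0]) v /\
    forall w, vset R w -> w <> v -> indegree_is R w 1 /\ outdegree_is R w 1.

Definition directed_away (G : digraph) (T R : subgraph G) (e : edge G) : Prop :=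
  exists C, [/\ weak_component (delete_edge T e) C, subgraph_of R C
              & vset C (etail e)].

Section Pseudo_arborescences.
Variable G : digraph.

Definition bipartition (X Y : set (vertex G)) : Prop :=
  [/\ X `|` Y = setT, X `&` Y = set0, X !=set0 & Y !=set0].

Definition directed_from (X Y : set (vertex G)) : set (edge G) :=
  [set e | X (etail e) /\ Y (ehead e)].

Definition meets_finite_cuts (r : vertex G) (F : set (edge G)) : Prop :=
  forall X Y, bipartition X Y -> X r ->
    finite_set (directed_from X Y `|` directed_from Y X) ->
    F `&` directed_from X Y !=set0.

Definition spanning_pseudo_arborescence (r : vertex G) (F : set (edge G)) :
    Prop :=
  meets_finite_cuts r F /\
  forall F', meets_finite_cuts r F' -> F' `<=` F -> F' = F.

End Pseudo_arborescences.

(* Main.v *)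
Require Import Defs.
From mathcomp Require Import all_boot.
From mathcomp Require Import boolp classical_sets functions cardinality.

Local Open Scope classical_set_scope.

Set Implicit Arguments.
Unset Strict Implicit.
Unset Printing Implicit Defensive.

(** In a minimal [F], every edge [e] is the only edge of [F] across some finite
    cut from the root side, a tight cut for [e]; uncrossing the tight cuts of two
    edges with the same head shows that the edges coincide.  Given unique heads,
    following edges of [F] backwards never revisits a vertex, since a finite set
    of vertices avoiding [r] must be entered by [F]; hence a component without
    [r] contains a backwards ray, and every backward walk in it merges with this
    ray.  Conversely, if two edges with a common head in a tree both pointed away
    from the ray, then removing one would separate the ray from the common head,
    which the other still reaches from the ray. *)

(** * Undirected linkage, weak components, and bridges in trees *)

Section Connectivity.
Variable G : digraph.
Implicit Types (D H T R : subgraph G) (u v w : vertex G) (e : edge G).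

Definition linked D u v : Prop :=
  exists n x f, [/\ walk D n x f, x 0 = u & x n = v].

Lemma joinsC e u v : joins e u v -> joins e v u.
Proof. by case; [right|left]. Qed.

Lemma joins_edge e : joins e (etail e) (ehead e).
Proof. by left. Qed.

Lemma joins_vset D e u v : eset D e -> joins e u v -> vset D u /\ vset D v.
Proof.
move=> De; case=> -[<- <-].
  by split; [exact: vset_etail|exact: vset_ehead].
by split; [exact: vset_ehead|exact: vset_etail].
Qed.

(* A trivial walk still carries a sequence of edges, so the digraph must have
   at least one. *)
Lemma linked_refl e D u : vset D u -> linked D u u.
Proof. by move=> Du; exists 0, (fun=> u), (fun=> e). Qed.

Lemma linked_step D e u v w :
  linked D u v -> eset D e -> joins e v w -> linked D u w.
Proof.
move=> [n [x [f [[Dx0 xf] x0 xn]]]] De vw.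
exists n.+1, (fun i => if i <= n then x i else w),
  (fun i => if i < n then f i else e); split=> //=; last by rewrite ltnn.
split=> // i; rewrite ltnS {1}leq_eqVlt => /predU1P[->|lin] /=.
  by rewrite leqnn ltnn xn.
by rewrite lin (ltnW lin); exact: xf.
Qed.

(** Lets later proofs propagate a property edge by edge, in either direction, instead of handling
    indexed walks. *)
Lemma linked_ind D (P : vertex G -> Prop) u v :
  linked D u v -> P u ->
  (forall e a b, eset D e -> joins e a b -> P a -> P b) -> P v.
Proof.
move=> [n [x [f [[_ xf] <- <-]]]] P0 PS.
suff: forall i, i <= n -> P (x i) by apply.
elim=> [//|i IHi] lin; have [Df xi] := xf i lin.
exact: PS Df xi (IHi (ltnW lin)).
Qed.

Lemma linked_refl_l D u v : linked D u v -> linked D u u.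
Proof.
by move=> [n [x [f [[Dx0 _] <- _]]]]; exact: (linked_refl (f 0) Dx0).
Qed.

Lemma linked_trans D u v w : linked D u v -> linked D v w -> linked D u w.
Proof.
move=> uv vw; apply: (linked_ind (P := linked D u) vw uv) => e a b De ab ua.
exact: linked_step ua De ab.
Qed.

Lemma linked_joins D e u v : eset D e -> joins e u v -> linked D u v.
Proof.
move=> De uv; have [Du _] := joins_vset De uv.
exact: linked_step (linked_refl e Du) De uv.
Qed.

Lemma linked_sym D u v : linked D u v -> linked D v u.
Proof.
move=> uv; apply: (linked_ind (P := linked D ^~ u) uv) => [|e a b De ab au].
  exact: linked_refl_l uv.
exact: linked_trans (linked_joins De (joinsC ab)) au.
Qed.

Lemma linked_vset D u v : linked D u v -> vset D v.
Proof.
move=> uv; apply: (linked_ind uv) => [|e a b De ab _].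
  by have [n [x [f [[? _] <- _]]]] := uv.
by case: (joins_vset De ab).
Qed.

Lemma linked_subgraph H D u v : subgraph_of H D -> linked H u v -> linked D u v.
Proof.
move=> [HDv HDe] [n [x [f [[Hx0 xf] x0 xn]]]].
exists n, x, f; split=> //; split; first exact: HDv.
by move=> i /xf[/HDe].
Qed.

(** A simple path is grown one edge at a time: if the new end [b] already lies on it, the path is
    cut there, otherwise it is extended. *)
Lemma linked_simple D u v : linked D u v ->
  exists n x f, [/\ walk D n x f, x 0 = u, x n = v
    & forall i j, i <= n -> j <= n -> x i = x j -> i = j].
Proof.
move=> uv; pattern v; apply: (linked_ind uv).
  have [_ [x [f [[Dx0 _] x0 _]]]] := uv.
  by exists 0, x, f; split=> // i j; rewrite !leqn0 => /eqP-> /eqP->.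
move=> e a b De ab [n [x [f [[Dx0 xf] x0 xn xinj]]]].
have [[k kn xk]|nob] := pselect (exists2 k, k <= n & x k = b).
  exists k, x, f; split=> //.
    by split=> // i ik; apply: xf; exact: leq_trans ik kn.
  by move=> i j ik jk; apply: xinj; [exact: leq_trans kn|exact: leq_trans kn].
exists n.+1, (fun i => if i <= n then x i else b),
  (fun i => if i < n then f i else e); split=> //=; last 2 first.
- by rewrite ltnn.
- move=> i j; rewrite {1}(leq_eqVlt i) {1}(leq_eqVlt j) !ltnS.
  move=> /predU1P[->|lin] /predU1P[->|ljn] //; rewrite ?ltnn ?lin ?ljn.
  + by move=> bx; case: nob; exists j.
  + by move=> xb; case: nob; exists i.
  + exact: xinj.
split=> // i; rewrite ltnS {1}leq_eqVlt => /predU1P[->|lin] /=.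
  by rewrite leqnn ltnn xn.
by rewrite lin (ltnW lin); exact: xf.
Qed.

(** A simple path between the ends of [e] that avoids [e] would close up with [e] to a cycle. *)
Lemma tree_bridge T e : underlying_tree T -> eset T e ->
  ~ linked (delete_edge T e) (etail e) (ehead e).
Proof.
move=> [_ acyclic] Te /linked_simple[n [x [f [[Tx0 xf] x0 xn xinj]]]].
have n0 : 0 < n.
  by rewrite lt0n; apply/eqP => n0; apply: (@no_loop G e); rewrite -x0 -xn n0.
(* Edges of a simple path are distinct: equal edges have equal ends, so [x i] would be [x j] or
   [x j.+1], impossible for [i < j]. *)
have finj i j : i < n -> j < n -> f i = f j -> i <= j -> i = j.
  move=> lin ljn fij; rewrite leq_eqVlt => /predU1P[//|ij].
  have [_ xi] := xf i lin; have [_ xj] := xf j ljn.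
  move: xi xj; rewrite fij => xi xj.
  have : x i = x j \/ x i = x j.+1.
    by case: xi xj => -[? ?] [] [? ?];
      first [left; congruence|right; congruence].
  move=> [] xij.
    by apply: xinj => //; exact: ltnW.
  by have iE := xinj _ _ (ltnW lin) ljn xij; move: ij; rewrite iE ltnNge leqnSn.
apply: acyclic; exists n.+1, (fun i => if i <= n then x i else etail e),
  (fun i => if i < n then f i else e); split=> //=.
- split=> // i; rewrite ltnS {1}leq_eqVlt => /predU1P[->|lin] /=.
    by rewrite leqnn !ltnn xn; split=> //; right.
  by rewrite lin (ltnW lin); have [[]] := xf i lin.
- by rewrite ltnn x0.
- by move=> i j; rewrite !ltnS => lin ljn; rewrite lin ljn; exact: xinj.
move=> i j; rewrite !ltnS {1}(leq_eqVlt i) {1}(leq_eqVlt j).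
move=> /predU1P[->|lin] /predU1P[->|ljn] //; rewrite ?ltnn ?lin ?ljn.
- by have [[_ fe] _] := xf j ljn => ef; case: fe.
- by have [[_ fe] _] := xf i lin => ef; case: fe.
move=> fij; case/orP: (leq_total i j) => ij; first exact: finj.
by apply/esym; exact: finj.
Qed.

(** Testing only the tail of an edge suffices, since the edge itself then links its head to [u]. *)
Definition component D u : subgraph G :=
  @Subgraph G (linked D u) [set e | eset D e /\ linked D u (etail e)]
    (fun e De => proj2 De)
    (fun e De => linked_step (proj2 De) (proj1 De) (joins_edge e)).

Lemma component_subgraph D u : subgraph_of (component D u) D.
Proof. by split=> [v /linked_vset|e []]. Qed.

Lemma component_linked e D u v : vset D u ->
  linked D u v -> linked (component D u) u v.
Proof.
(* The induction carries linkage in [D] as well, because membership of an edge in the component is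
   expressed by it. *)
move=> Du uv; have : linked D u v /\ linked (component D u) u v; last by case.
have uu := linked_refl e Du; pattern v.
apply: (linked_ind uv) => [|f a b Df ab [ua cua]].
  by split=> //; exact: (linked_refl e).
have ub := linked_step ua Df ab; split=> //.
apply: (linked_step cua _ ab); split=> //.
by case: ab => -[-> _].
Qed.

Lemma component_connected e D u : vset D u ->
  weakly_connected (component D u).
Proof.
move=> Du; split; first by exists u; exact: (linked_refl e).
move=> v w uv uw; apply: linked_trans (component_linked e Du uw).
exact: linked_sym (component_linked e Du uv).
Qed.

Lemma connected_subgraph_component D H u :
  subgraph_of H D -> weakly_connected H -> vset H u ->
  subgraph_of H (component D u).
Proof.
move=> HD [_ Hc] Hu; have uv v : vset H v -> linked D u v.
  by move=> Hv; apply: (linked_subgraph HD); exact: Hc.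
split=> [v /uv//|e He]; split; first exact: (proj2 HD).
exact/uv/vset_etail.
Qed.

Lemma weak_component_component e D u : vset D u ->
  weak_component D (component D u).
Proof.
move=> Du; split; [exact: component_subgraph|exact: component_connected|].
move=> H HD Hc [uH _]; apply: connected_subgraph_component => //.
by apply: uH; exact: (linked_refl e).
Qed.

(** The component of [u] contains both [T] and [e], so by maximality of [T] it lies in [T]. *)
Lemma weak_component_joins D T e u v :
  weak_component D T -> vset T u -> eset D e -> joins e u v ->
  eset T e /\ vset T v.
Proof.
move=> [TD Tc Tmax] Tu De uv; have Du := proj1 TD _ Tu.
suff Te : eset T e by split=> //; case: (joins_vset Te uv).
apply: (proj2 (Tmax _ (component_subgraph D u) (component_connected e Du)
  (connected_subgraph_component TD Tc Tu))).
split=> //; have uu := linked_refl e Du.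
case: uv => -[? ?]; subst => //.
exact: linked_step uu De (joinsC (joins_edge e)).
Qed.

Lemma directed_away_linked T R e u : directed_away T R e -> vset R u ->
  linked (delete_edge T e) (etail e) u.
Proof.
move=> [C [[CT [_ Cc] _] [RC _] Ce]] Ru.
by apply: (linked_subgraph CT); apply: Cc => //; exact: RC.
Qed.

Lemma tree_directed_away_head T R e f : underlying_tree T ->
  vset R !=set0 ->
  (forall e' f', eset R e' -> eset R f' -> ehead e' = ehead f' -> e' = f') ->
  (forall e', eset T e' -> ~ eset R e' -> directed_away T R e') ->
  eset T e -> eset T f -> ehead e = ehead f -> e = f.
Proof.
move=> tree [a Ra] Rinj away Te Tf ef.
(* If just one of the edges lies on [R], the common head is on [R], so the other edge, pointing away
   from [R], would have its ends linked without it. *)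
have mixed e' f' : eset T f' -> eset R e' -> ~ eset R f' ->
    ehead e' <> ehead f'.
  move=> Tf' Re' Rf' ef'; apply: (tree_bridge tree Tf').
  rewrite -ef'.
  exact: directed_away_linked (away _ Tf' Rf') (vset_ehead Re').
have [Re|Re] := pselect (eset R e); have [Rf|Rf] := pselect (eset R f).
- exact: Rinj.
- by case: (mixed e f).
- by case: (mixed f e).
have ea := directed_away_linked (away e Te Re) Ra.
have fa := directed_away_linked (away f Tf Rf) Ra.
apply: contrapT => ne.
(* The component of [T - e] containing [R] misses the common head, hence does
   not use [f] and survives in [T - f]. *)
have : linked (delete_edge T e) (etail e) (etail e) /\
       linked (delete_edge T f) (etail f) (etail e).
  pattern (etail e) at 2 3.
  apply: (linked_ind (linked_sym ea)) => // g b c Tg bc [eb fb].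
  have ec := linked_step eb Tg bc; split=> //.
  apply: (linked_step fb _ bc); split; first exact: (proj1 Tg).
  move=> gf; apply: (tree_bridge tree Te); rewrite ef -gf.
  by case: bc => -[_ ->].
(* In [T - f] the tail of [f] is linked to the tail of [e], and [e] leads on to the common head. *)
move=> [_ fe]; apply: (tree_bridge tree Tf); rewrite -ef.
by apply: (linked_step fe _ (joins_edge e)); split=> // ?; exact: ne.
Qed.

End Connectivity.

Lemma card_eq_I1 (T : Type) (A : set T) :
  (A #= `I_1)%card <-> exists x, A = [set x].
Proof.
split=> [/eq_cardSP[x Ax]|[x ->]]; last exact: card_set1.
rewrite II0 card_eq0 => /eqP AD; exists x; apply/seteqP; split=> [y Ay|_ ->//].
by apply: contrapT => yx; have : set0 y by rewrite -AD.
Qed.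

(** * Finite cuts, and tight cuts of a minimal edge set *)

Section Cuts.
Variables (G : digraph) (r : vertex G).
Implicit Types (X Y : set (vertex G)) (F : set (edge G)).

(** Every edge across the cut is incident with one of the finitely many vertices of [Y]. *)
Lemma finite_set_cut Y : locally_finite G -> finite_set Y ->
  finite_set (directed_from (~` Y) Y `|` directed_from Y (~` Y)).
Proof.
move=> lf finY; apply: (@sub_finite_set _ _
  (\bigcup_(v in Y) (in_edges (full G) v `|` out_edges (full G) v))).
  by move=> e [] [te he]; [exists (ehead e)|exists (etail e)] => //;
    [left|right].
by apply: bigcup_finite => // v _; have [? ?] := lf v; rewrite finite_setU.
Qed.

Lemma finite_set_entered F Y : locally_finite G -> meets_finite_cuts r F ->
  finite_set Y -> Y !=set0 -> ~ Y r ->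
  exists e, [/\ F e, ~ Y (etail e) & Y (ehead e)].
Proof.
move=> lf meetsF finY Y0 Yr.
have [|e [Fe [te he]]] := meetsF (~` Y) Y _ Yr (finite_set_cut lf finY).
  by split=> //; [rewrite setUC setUv|rewrite setIC setICr|exists r].
by exists e.
Qed.

Lemma vertex_entered F v : locally_finite G -> meets_finite_cuts r F ->
  v <> r -> exists2 e, F e & ehead e = v.
Proof.
move=> lf meetsF vr.
have [|||e [Fe _ he]] := @finite_set_entered F [set v] lf meetsF.
- exact: finite_set1.
- by exists v.
- by move=> rv; apply: vr.
by exists e.
Qed.

Lemma not_meets_finite_cuts_delete F e :
  spanning_pseudo_arborescence r F -> F e ->
  ~ meets_finite_cuts r (F `\ e).
Proof.
move=> [_ minF] Fe /minF FE; have : (F `\ e) e by rewrite FE // => ? [].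
by move=> [_]; apply.
Qed.

(** By minimality, deleting [e] leaves some finite cut unmet; [F] meets that cut, so it does so in
    [e] alone. *)
Lemma tight_cut F e : spanning_pseudo_arborescence r F -> F e ->
  exists X Y, [/\ bipartition X Y, X r,
    finite_set (directed_from X Y `|` directed_from Y X), directed_from X Y e
    & forall f, F f -> directed_from X Y f -> f = e].
Proof.
move=> pF Fe; apply: contrapT => notight.
apply: (not_meets_finite_cuts_delete pF Fe) => X Y XY Xr finXY.
apply: contrapT => nomeet; apply: notight; exists X, Y.
have onlye f : F f -> directed_from X Y f -> f = e.
  by move=> Ff XYf; apply: contrapT => fe; apply: nomeet; exists f.
split=> //; have [f [Ff XYf]] := (proj1 pF) X Y XY Xr finXY.
by rewrite -(onlye f Ff XYf).
Qed.

Lemma bipartition_in X Y v : bipartition X Y -> X v \/ Y v.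
Proof. by move=> [XY _ _ _]; have : (X `|` Y) v by rewrite XY. Qed.

Lemma bipartition_notin X Y v : bipartition X Y -> X v -> ~ Y v.
Proof. by move=> [_ XY _ _] Xv Yv; have : (X `&` Y) v by []; rewrite XY. Qed.

(* Uncrossing: an edge of [F] leaving the intersection of the root sides of the
   tight cuts of [e] and [f] crosses one of them, so it is [e] or [f]; as it
   starts in both root sides and [e] and [f] share their head, it crosses
   both. *)
Lemma spa_head_inj F e f : spanning_pseudo_arborescence r F ->
  F e -> F f -> ehead e = ehead f -> e = f.
Proof.
move=> pF Fe Ff ef.
have [X [Y [XY Xr finX [Xe Ye] onlye]]] := tight_cut pF Fe.
have [X' [Y' [XY' Xr' finX' [Xf Yf] onlyf]]] := tight_cut pF Ff.
have [||| g [Fg [[Xg Xg'] YYg]]] := (proj1 pF) (X `&` X') (Y `|` Y').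
- split.
  + apply/seteqP; split=> // v _.
    move: (bipartition_in v XY) (bipartition_in v XY').
    by case=> ?; case=> ?; rewrite /setU /setI /=; tauto.
  + apply/seteqP; split=> // v [[Xv Xv'] []] ?.
      exact: (bipartition_notin XY Xv).
    exact: (bipartition_notin XY' Xv').
  + by exists r.
  + by exists (ehead e); left.
- by [].
- apply: (@sub_finite_set _ _
    ((directed_from X Y `|` directed_from Y X) `|`
     (directed_from X' Y' `|` directed_from Y' X'))).
    by move=> h; rewrite /directed_from /setU /setI /=; tauto.
  by rewrite finite_setU.
case: YYg => Yg.
  have ge : g = e by apply: onlye.
  by rewrite -ge; apply: onlyf => //; split; rewrite // ge ef.
have gf : g = f by apply: onlyf.
by rewrite -gf; apply/esym/onlye => //; split; rewrite // gf -ef.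
Qed.

Lemma spa_head_root F e : spanning_pseudo_arborescence r F ->
  F e -> ehead e <> r.
Proof.
move=> pF Fe er; have [X [Y [XY Xr _ [_ Ye] _]]] := tight_cut pF Fe.
by apply: (bipartition_notin XY Xr); rewrite -er.
Qed.

End Cuts.

(** * Minimality and the shape of components, given unique heads *)

Section Unique_heads.
Variables (G : digraph) (r : vertex G) (F : set (edge G)).
Hypotheses (lf : locally_finite G) (meetsF : meets_finite_cuts r F).
Hypothesis head_inj : forall e f, F e -> F f -> ehead e = ehead f -> e = f.
Hypothesis head_root : forall e, F e -> ehead e <> r.

(** A smaller edge set meeting all finite cuts still enters the head of each [e] in [F], and only
    [e] can do so. *)
Lemma unique_heads_spa : spanning_pseudo_arborescence r F.
Proof.
split=> // F' meetsF' F'F; apply/seteqP; split=> // e Fe.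
have [f F'f fe] := vertex_entered lf meetsF' (head_root Fe).
by rewrite -(head_inj (F'F _ F'f) Fe fe).
Qed.

(** Rules out finite non-empty vertex sets avoiding [r] in which every vertex has an edge of [F]
    coming from inside the set. *)
Lemma finite_set_entered_uniq Y : finite_set Y -> Y !=set0 -> ~ Y r ->
  exists2 v, Y v & forall e, F e -> ehead e = v -> ~ Y (etail e).
Proof.
move=> finY Y0 Yr.
have [e [Fe te he]] := finite_set_entered lf meetsF finY Y0 Yr.
by exists (ehead e) => // f Ff fe; rewrite (head_inj Ff Fe fe).
Qed.

(* The [n] edges of a cycle have distinct heads among its [n] vertices, so every
   edge of [F] entering the vertex set of the cycle lies on the cycle. *)
Lemma unique_heads_acyclic D n x f : eset D `<=` F -> ~ cycle_in D n x f.
Proof.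
move=> DF [n0 [_ xf] xn xinj finj].
have tx i : i < n -> exists2 j, j < n & x j = x i.+1.
  rewrite leq_eqVlt => /predU1P[->|lin]; first by exists 0.
  by exists i.+1.
have ends i : i < n -> (exists j : 'I_n, x j = ehead (f i)) /\
    (exists j : 'I_n, x j = etail (f i)).
  move=> lin; have [j ljn xj] := tx i lin; have [_ xi] := xf i lin.
  have I1 : exists k : 'I_n, x k = x i by exists (Ordinal lin).
  have I2 : exists k : 'I_n, x k = x i.+1 by exists (Ordinal ljn).
  by case: xi => -[-> ->].
have Ff (i : 'I_n) : F (f i) by apply: DF; have [] := xf i (ltn_ord i).
have [h hE] := choice (fun i : 'I_n => (ends i (ltn_ord i)).1).
have h_inj : injective h.
  move=> i j hij; apply/val_inj/(finj _ _ (ltn_ord i) (ltn_ord j)).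
  by apply: head_inj; rewrite -?hE ?hij.
have [h' _ h'K] := injF_bij h_inj.
pose Y := range (fun i : 'I_n => x i).
have headY (i : 'I_n) : ehead (f (h' i)) = x i by rewrite -hE h'K.
have [|||_ [i _ <-] /(_ (f (h' i)))] := @finite_set_entered_uniq Y.
- exact: finite_image.
- by exists (x 0); exists (Ordinal n0).
- by move=> [i _ xr]; apply: (head_root (Ff (h' i))); rewrite headY.
apply=> //.
by have [_ [j xj]] := ends (h' i) (ltn_ord _); exists j.
Qed.

(** * Following edges of [F] backwards *)

Section Backward_walk.
Variable inn : vertex G -> edge G.
Hypothesis inn_F : forall v, v <> r -> F (inn v).
Hypothesis inn_head : forall v, v <> r -> ehead (inn v) = v.

(** As [inn] is unconstrained at [r], this traces a walk in [F] only until [r] is reached. *)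
Definition back (n : nat) (v : vertex G) : vertex G :=
  iter n (fun u => etail (inn u)) v.

Lemma backS n v : back n.+1 v = etail (inn (back n v)).
Proof. by []. Qed.

Lemma backSr n v : back n.+1 v = back n (etail (inn v)).
Proof. exact: iterSr. Qed.

(** After a repetition at times [i < j], the first [j] vertices would form a finite set avoiding [r]
    that [F] never enters. *)
Lemma back_inj v : (forall n, back n v <> r) -> injective (back ^~ v).
Proof.
move=> nor; suff lt_neq i j : i < j -> back i v <> back j v.
  move=> i j bij; case: (ltngtP i j) => // ij; first by case: (lt_neq _ _ ij).
  by case: (lt_neq _ _ ij).
move=> ij bij; pose Y := (back ^~ v) @` `I_j.
have [|||_ [k kj <-] /(_ (inn (back k v)))] := @finite_set_entered_uniq Y.
- exact/finite_image/finite_II.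
- by exists (back i v); exists i.
- by move=> [k _] /nor.
move=> /(_ (inn_F (nor k)) (inn_head (nor k))); apply.
(* The predecessor of the last vertex, at time [j], is again in [Y] because it equals the one at
   time [i]. *)
move: kj; rewrite /= leq_eqVlt => /predU1P[kj|kj]; last by exists k.+1.
by exists i => //; rewrite bij -kj.
Qed.


Lemma inn_unique e : F e -> e = inn (ehead e).
Proof.
move=> Fe; have er := head_root Fe.
by apply: head_inj => //; [exact: inn_F|rewrite inn_head].
Qed.

Lemma joins_inn v : v <> r -> joins (inn v) v (etail (inn v)).
Proof. by move=> vr; right; rewrite inn_head. Qed.

(** * A backward walk that never reaches [r], as a backwards ray *)

Section Back_ray.
Variable v : vertex G.
Hypothesis back_root : forall n, back n v <> r.

Lemma back_ray_etail e : range (fun n => inn (back n v)) e ->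
  range (back ^~ v) (etail e).
Proof. by move=> [n _ <-]; exists n.+1. Qed.

Lemma back_ray_ehead e : range (fun n => inn (back n v)) e ->
  range (back ^~ v) (ehead e).
Proof. by move=> [n _ <-]; exists n => //=; rewrite inn_head. Qed.

Definition back_ray : subgraph G := Subgraph back_ray_etail back_ray_ehead.

Lemma back_ray_linked n : linked back_ray v (back n v).
Proof.
elim: n => [|n IHn]; first by apply: (linked_refl (inn v)); exists 0.
rewrite backS; apply: (linked_step IHn _ (joins_inn (@back_root n))).
by exists n.
Qed.

Lemma back_ray_connected : weakly_connected back_ray.
Proof.
split; first by exists v; exists 0.
move=> _ _ [m _ <-] [n _ <-].
exact: linked_trans (linked_sym (back_ray_linked m)) (back_ray_linked n).
Qed.

Lemma back_ray_indegree n : indegree_is back_ray (back n v) 1.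
Proof.
apply/card_eq_I1; exists (inn (back n v)); apply/seteqP; split=> [e|_ ->].
  by move=> [[m _ <-]]; rewrite inn_head // => /= ->.
by split; [exists n|exact: inn_head].
Qed.

Lemma back_ray_outdegree0 : outdegree_is back_ray v 0.
Proof.
rewrite /outdegree_is II0 card_eq0; apply/eqP/seteqP; split=> // e.
by move=> [[m _ <-]] tm; have := @back_inj v (@back_root) m.+1 0 tm.
Qed.

Lemma back_ray_outdegree1 n : outdegree_is back_ray (back n.+1 v) 1.
Proof.
apply/card_eq_I1; exists (inn (back n v)); apply/seteqP; split=> [e|_ ->].
  move=> [[m _ <-]] tm.
  by have [->] := @back_inj v (@back_root) m.+1 n.+1 tm.
by split; first by exists n.
Qed.

Lemma back_ray_backwards : backwards_ray back_ray.
Proof.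
split; first exact: back_ray_connected.
exists v; split; last first.
  move=> _ [[|n] _ <-] // _; split; first exact: (back_ray_indegree n.+1).
  exact: back_ray_outdegree1.
split; first split.
- by exists 0.
- exact: (back_ray_indegree 0).
- exact: back_ray_outdegree0.
move=> _ [[[|n] _ <-] _ //].
rewrite /outdegree_is II0 card_eq0 => /eqP out0.
have /card_eq_I1[e outE] := back_ray_outdegree1 n.
by have : set0 e by rewrite -out0 outE.
Qed.

End Back_ray.

(** * Weak components of the subgraph spanned by [F] *)

Section Component.
Variable T : subgraph G.
Hypothesis wcT : weak_component (edge_subgraph F) T.

Lemma component_sub_F : eset T `<=` F.
Proof. by case: wcT => -[]. Qed.

Lemma component_inn v : vset T v -> v <> r ->
  eset T (inn v) /\ vset T (etail (inn v)).
Proof.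
move=> Tv vr; have Fv := inn_F vr.
exact: (weak_component_joins wcT Tv Fv (joins_inn vr)).
Qed.

Lemma component_tree : underlying_tree T.
Proof.
split; first by case: wcT.
by move=> [n [x [f]]]; apply: unique_heads_acyclic component_sub_F.
Qed.

Lemma component_arborescence : vset T r -> arborescence T r.
Proof.
move=> Tr; split=> //; first exact: component_tree.
  rewrite /indegree_is II0 card_eq0; apply/eqP/seteqP; split=> // e.
  by move=> [Te er]; apply: head_root (component_sub_F Te) er.
move=> v Tv vr; apply/card_eq_I1; exists (inn v); apply/seteqP.
split=> [e [Te <-]|_ ->]; first exact/inn_unique/component_sub_F.
by split; [case: (component_inn Tv vr)|exact: inn_head].
Qed.

Hypothesis Tr : ~ vset T r.

Lemma component_back n v : vset T v -> vset T (back n v).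
Proof.
move=> Tv; elim: n => [//|n IHn].
by apply: (proj2 (component_inn IHn _)) => nr; apply: Tr; rewrite -nr.
Qed.

Lemma component_back_root n v : vset T v -> back n v <> r.
Proof. by move=> Tv nr; apply: Tr; rewrite -nr; exact: component_back. Qed.

(** Induction along an undirected walk from [v] to [u]: passing to the tail of an edge moves the
    meeting point one step back, passing to the head adds one step to the walk from [u]. *)
Lemma component_back_meet u v : vset T u -> vset T v ->
  exists m n, back m u = back n v.
Proof.
move=> Tu Tv; have [_ Tc] : weakly_connected T by case: wcT.
pattern u; apply: (linked_ind (Tc v u Tv Tu)); first by exists 0, 0.
have up a m n e : eset T e -> ehead e = a -> back m a = back n v ->
    exists m n, back m (etail e) = back n v.
  move=> Te ea mn; exists m, n.+1; rewrite backS -mn -backS backSr -ea.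
  by rewrite -inn_unique //; exact: component_sub_F.
have down a m n e : eset T e -> etail e = a -> back m a = back n v ->
    exists m n, back m (ehead e) = back n v.
  move=> Te ea mn; exists m.+1, n; rewrite -mn backSr.
  by rewrite -inn_unique ?ea //; exact: component_sub_F.
move=> e a b Te; case=> -[<- <-] [m [n mn]].
  exact: down Te erefl mn.
exact: up Te erefl mn.
Qed.

(** The ray may start at any vertex [v]. For [e] off the ray, the backward walk from its tail avoids
    [e] and meets the ray, so the component of the tail in [T - e] contains the ray. *)
Lemma component_back_ray : exists R : subgraph G,
  [/\ backwards_ray R, subgraph_of R T
    & forall e : edge G, eset T e -> ~ eset R e -> directed_away T R e].
Proof.
have [[[v Tv] _] _] := component_tree.
have nor n := @component_back_root n v Tv.
have inT n u : vset T u -> eset T (inn (back n u)).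
  move=> Tu; apply: (proj1 (component_inn (component_back n Tu) _)).
  exact: component_back_root.
exists (back_ray nor); split; first exact: back_ray_backwards.
  by split=> [_ [n _ <-]|_ [n _ <-]]; [exact: component_back|exact: inT].
move=> e Te Re; set t := etail e.
have Tt : vset T t := vset_etail Te.
have tt : linked (delete_edge T e) t t by apply: (linked_refl e).
have rayTe : subgraph_of (back_ray nor) (delete_edge T e).
  split=> [_ [n _ <-]|f Rf]; first exact: component_back.
  split; last by move=> fe; apply: Re; rewrite -fe.
  by case: Rf => n _ <-; exact: inT.
(* If [e] lay on the backward walk from its tail, this walk would return. *)
have tback n : linked (delete_edge T e) t (back n t).
  have bt k := @component_back_root k t Tt.
  elim: n => [//|n IHn]; rewrite backS.
  apply: (linked_step IHn _ (joins_inn (bt n))).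
  split; first exact: inT.
  by move=> /= ine; have := @back_inj t bt n.+1 0; rewrite /= ine => /(_ erefl).
have tv : linked (delete_edge T e) t v.
  have [m [n mn]] := component_back_meet Tt Tv.
  apply: linked_trans (tback m) _; rewrite mn; apply: linked_sym.
  exact: linked_subgraph rayTe (back_ray_linked nor n).
exists (component (delete_edge T e) t); split.
- exact: (weak_component_component e).
- have [Rv Rc] : vset (back_ray nor) v /\ weakly_connected (back_ray nor).
    by split; [exists 0|exact: back_ray_connected].
  have [Cv Ce] := connected_subgraph_component rayTe Rc Rv.
  split=> [u /Cv|f /Ce[Tf vf]]; first exact: linked_trans tv.
  by split=> //; exact: linked_trans vf.
- exact: tt.
Qed.

End Component.

End Backward_walk.

End Unique_heads.

(** * From the shape of the components back to unique heads *)

Section Components_to_unique_heads.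
Variables (G : digraph) (r : vertex G) (F : set (edge G)).
Hypothesis compF : forall T, weak_component (edge_subgraph F) T ->
  (vset T r -> arborescence T r) /\
  (~ vset T r -> underlying_tree T /\ exists R : subgraph G,
    [/\ backwards_ray R, subgraph_of R T
      & forall e : edge G, eset T e -> ~ eset R e -> directed_away T R e]).

Lemma indegree1_inj (D : subgraph G) v e f : indegree_is D v 1 ->
  eset D e -> eset D f -> ehead e = v -> ehead f = v -> e = f.
Proof.
move=> /card_eq_I1[g inE] De Df ev fv.
have : in_edges D v e by []. have : in_edges D v f by [].
by rewrite inE => -> ->.
Qed.

(** Gathers all edges of [F] with a common head in one component, to which [compF] applies. *)
Lemma edge_component e : F e -> exists T,
  [/\ weak_component (edge_subgraph F) T, vset T (ehead e)
    & forall f, F f -> ehead f = ehead e -> eset T f].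
Proof.
move=> Fe; have De : vset (edge_subgraph F) (ehead e) by exists e => //; right.
exists (component (edge_subgraph F) (ehead e)).
have wc := weak_component_component e De.
have Te := linked_refl e De; split=> // f Ff fe.
apply: (proj1 (weak_component_joins (v := etail f) wc Te Ff _)).
by right.
Qed.

Lemma components_head_root e : F e -> ehead e <> r.
Proof.
move=> Fe er; have [T [wcT Te Tin]] := edge_component Fe.
have [+ _] := compF wcT; rewrite -er => /(_ Te)[_ _ + _].
rewrite /indegree_is II0 card_eq0 => /eqP in0.
have : in_edges T (ehead e) e by split=> //; exact: Tin.
by rewrite in0.
Qed.

Lemma components_head_inj e f : F e -> F f -> ehead e = ehead f -> e = f.
Proof.
move=> Fe Ff ef; have [T [wcT Tv Tin]] := edge_component Fe.
have Te := Tin e Fe erefl; have Tf := Tin f Ff (esym ef).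
have [arb nonarb] := compF wcT.
have [Tr|Tr] := pselect (vset T r).
  have [_ _ _ in1] := arb Tr.
  exact: (indegree1_inj (in1 _ Tv (components_head_root Fe))).
have [tree [R [[[R0 _] [v [[[_ inv _] _] Rin]]] RT away]]] := nonarb Tr.
apply: (tree_directed_away_head tree R0 _ away) => // e' f' Re' Rf' ef'.
apply: (indegree1_inj (v := ehead e') (D := R)) => //.
(* The first vertex [v] of the ray differs from the others only in out-degree; its in-degree is also
   one. *)
have [->//|ev] := pselect (ehead e' = v).
by case: (Rin _ (vset_ehead Re') ev).
Qed.

End Components_to_unique_heads.

Theorem theorem1p6 (G : digraph) (r : vertex G) (F : set (edge G)) :
  locally_finite G ->
  weakly_connected (full G) ->
  meets_finite_cuts r F ->
  [<-> spanning_pseudo_arborescence r F;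
       (forall v : vertex G, v <> r -> exists! e : edge G, F e /\ ehead e = v) /\
       (forall e : edge G, F e -> ehead e <> r);
       forall T : subgraph G, weak_component (edge_subgraph F) T ->
         (vset T r -> arborescence T r) /\
         (~ vset T r ->
            underlying_tree T /\
            exists R : subgraph G,
              [/\ backwards_ray R, subgraph_of R T
                & forall e : edge G, eset T e -> ~ eset R e ->
                    directed_away T R e])].
Proof.
move=> lf _ meetsF; tfae.
- move=> pF; split; last by move=> e; exact: spa_head_root pF.
  move=> v vr; have [e Fe ev] := vertex_entered lf meetsF vr.
  exists e; split=> // f [Ff fv]; apply: (spa_head_inj pF) => //.
  by rewrite ev fv.
- move=> [uniq_head head_root] T wcT.
  have head_inj e f : F e -> F f -> ehead e = ehead f -> e = f.
    move=> Fe Ff ef; have [g [_ gU]] := uniq_head _ (head_root f Ff).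
    by rewrite -(gU e) // -(gU f).
  have [[u Du] _] : weakly_connected T by case: wcT.
  (* A component is non-empty and its vertices are ends of edges of [F]; such an edge [e0] serves as
     the default value of [inn] at [r]. *)
  have [e0 _ _] : vset (edge_subgraph F) u by case: wcT => -[+ _] _ _; apply.
  have inn_ex v : exists e, v <> r -> F e /\ ehead e = v.
    have [->|vr] := pselect (v = r); first by exists e0.
    by have [e [Fe _]] := uniq_head v vr; exists e.
  have [inn innP] := choice inn_ex.
  have inn_F v (vr : v <> r) := (innP v vr).1.
  have inn_head v (vr : v <> r) := (innP v vr).2.
  split=> Tr; first exact: (component_arborescence lf meetsF head_inj _ inn_F).
  split; first exact: (component_tree lf meetsF).
  exact: (component_back_ray lf meetsF head_inj head_root inn_F).
- move=> compF; apply: unique_heads_spa => //.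
    exact: components_head_inj compF.
  exact: components_head_root compF.
Qed.
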